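(* Let $T_1,T_2$ be nontrivial trees with $n_1$ and $n_2$ vertices respectively, where $n_1\le n_2$. Then $\chi_r(T_1+T_2)=2(r-1)$ for every integer $r$ with $4\le r\le n_1+1$.
   Context: All graphs are simple, connected and undirected. For a vertex $v$, $N_G(v)$ is its open neighborhood and $d(v)=|N_G(v)|$; $\Delta$ is the maximum degree. For a coloring $c$ and vertex set $S$, $c(S)=\{c(u):u\in S\}$. For integers $k>0$ and $0<r\le\Delta(G)$ with $r\le k$, a conditional $(k,r)$-coloring of $G$ is a surjective map $c:V(G)\to\{1,\dots,k\}$ such that (C1) $c(u)\ne c(v)$ whenever $uv\in E(G)$, and (C2) $|c(N_G(v))|\ge\min\{d(v),r\}$ for every vertex $v$. $\chi_r(G)$ is the smallest $k$ for which $G$ has a conditional $(k,r)$-coloring. The join $G_1+G_2$ has vertex set $V(G_1)\cup V(G_2)$ (disjoint) and edge set $E(G_1)\cup E(G_2)\cup\{u_1u_2:u_1\in V(G_1),u_2\in V(G_2)\}$. *)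

(* Defs.v *)
From mathcomp Require Import all_boot.

Set Implicit Arguments.
Unset Strict Implicit.
Unset Printing Implicit Defensive.

Record sgraph := SGraph {
  vertex :> finType;
  edge : rel vertex;
  edge_sym : symmetric edge;
  edge_irrefl : irreflexive edge
}.

Section Graph.
Variable G : sgraph.

Definition nbhd (v : G) : {set G} := [set u | edge v u].
Definition degree (v : G) : nat := #|nbhd v|.
Definition max_degree : nat := \max_(v : G) degree v.

Definition connected_graph : Prop :=
  0 < #|G| /\ forall u v : G, connect (@edge G) u v.

(* [ucycle] also accepts [::] and, as edges are symmetric, [:: u; v] with
   uv an edge; graph-theoretic cycles are those with at least 3 vertices. *)
Definition acyclic_graph : Prop :=
  forall p : seq G, ucycle (@edge G) p -> size p < 3.

Definition is_tree : Prop := connected_graph /\ acyclic_graph.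

Definition conditional_coloring (k r : nat) (c : G -> 'I_k) : Prop :=
  [/\ forall i : 'I_k, exists v : G, c v = i,
      forall u v : G, edge u v -> c u <> c v
    & forall v : G, minn (degree v) r <= #|c @: nbhd v|].

Definition conditional_colorable (k r : nat) : Prop :=
  [/\ 0 < k, 0 < r <= max_degree, r <= k
    & exists c : G -> 'I_k, conditional_coloring r c].

(* k = chi_r(G), as a relation: chi_r(G) is only defined for 0 < r <= Delta. *)
Definition is_chi (r k : nat) : Prop :=
  conditional_colorable k r /\
  forall k' : nat, conditional_colorable k' r -> k <= k'.

Lemma is_chi_unique (r k1 k2 : nat) : is_chi r k1 -> is_chi r k2 -> k1 = k2.
Proof.
move=> [c1 m1] [c2 m2]; apply/eqP.
by rewrite eqn_leq (m1 _ c2) (m2 _ c1).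
Qed.

End Graph.

Section Join.
Variables G1 G2 : sgraph.

Definition join_edge (x y : G1 + G2) : bool :=
  match x, y with
  | inl u, inl v => edge u v
  | inr u, inr v => edge u v
  | _, _ => true
  end.

Lemma join_edge_sym : symmetric join_edge.
Proof. by case=> u [] v //=; apply: edge_sym. Qed.

Lemma join_edge_irrefl : irreflexive join_edge.
Proof. by case=> u /=; apply: edge_irrefl. Qed.

Definition join_graph : sgraph := SGraph join_edge_sym join_edge_irrefl.

Lemma join_graph_connected : 0 < #|G1| -> 0 < #|G2| ->
  connected_graph join_graph.
Proof.
move=> /card_gt0P[a _] /card_gt0P[b _]; split.
  by apply/card_gt0P; exists (inl a : join_graph).
case=> u [] v.
- by apply: (@connect_trans _ _ (inr b : join_graph)); apply: connect1.
- exact: connect1.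
- exact: connect1.
- by apply: (@connect_trans _ _ (inl a : join_graph)); apply: connect1.
Qed.

End Join.

(* Main.v *)
Require Import Defs.
From mathcomp Require Import all_boot.

Set Implicit Arguments.
Unset Strict Implicit.
Unset Printing Implicit Defensive.

(** In a join the two sides use disjoint sets of colors.  A leaf of [T1] sees a
    single color of its own side, hence at least [r - 1] colors on [T2]; together
    with the symmetric bound this gives [2 (r - 1)].  Conversely a tree has a
    proper coloring using exactly [k] colors whenever [2 <= k <= n]: start from
    [k] vertices with distinct colors and add back, one at a time, vertices
    having at most one neighbor among those already colored.  Coloring each tree
    with its own [r - 1] colors, every vertex sees all the colors of the other
    tree and at least one of its own. *)

(** If the first vertex of a simple path in [S] has two neighbors in [S], one of them is not its
    successor; it either prolongs the path or closes a cycle. *)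
Lemma acyclic_low_degree (G : sgraph) (S : {set G}) :
  acyclic_graph G -> S != set0 -> exists2 v, v \in S & #|nbhd v :&: S| <= 1.
Proof.
move=> acG /set0Pn[x0 Sx0].
case: (boolP [exists v in S, #|nbhd v :&: S| <= 1]) => [/exists_inP //|].
rewrite negb_exists_in => /forall_inP big.
(* Otherwise simple paths inside [S] can be prolonged indefinitely. *)
have long n : exists x q,
    [/\ size q = n, path (@edge G) x q, uniq (x :: q) & {subset x :: q <= S}].
  elim: n => [|n [x [q [szq pq uq Sq]]]].
    by exists x0, [::]; split=> // y; rewrite inE => /eqP->.
  have Sx : x \in S by apply: Sq; rewrite mem_head.
  (* For empty [q] the default makes [head x q] equal to [x], which is not its own neighbor, so its
     removal is harmless. *)
  have [y yh /setIP[]] : exists2 y, y != head x q & y \in nbhd x :&: S.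
    have /card_gt0P[y] : 0 < #|(nbhd x :&: S) :\ head x q|.
      have := big x Sx; rewrite -ltnNge (cardsD1 (head x q)).
      by case: (_ \in _); case: #|_|.
    by case/setD1P => ? ?; exists y.
  rewrite inE => xy Sy.
  have yx : y != x by apply: contraTneq xy => ->; rewrite edge_irrefl.
  case: (boolP (y \in q)) => [/splitPr q_def|yq]; last first.
    exists y, (x :: q); split=> /=; first by rewrite szq.
    - by rewrite edge_sym xy.
    - by rewrite inE negb_or yx yq.
    - by move=> z; rewrite inE => /predU1P[->|/Sq].
  (* As [y] is not the successor of [x], some [z] lies between them on the path, and the cycle from
     [x] through [z] to [y] has at least 3 vertices. *)
  case: q_def pq uq yh => -[|z q1] q2 pq uq; first by rewrite eqxx.
  move: pq => /=; rewrite cat_path => /and4P[xz pz zy _] _.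
  suff /acG : ucycle (@edge G) [:: x, z & rcons q1 y] by rewrite /= size_rcons.
  apply/andP; split.
    by rewrite /= xz !rcons_path pz zy last_rcons edge_sym xy.
  by move: uq; rewrite -cat_rcons -cat_cons cat_uniq => /andP[].
(* A simple path with [#|G|] edges would visit [#|G| + 1] distinct vertices. *)
have [x [q [szq _ /card_uniqP + _]]] := long #|G|.
by have := max_card (mem (x :: q)); rewrite /= szq => /[swap] ->; rewrite ltnn.
Qed.

Lemma connected_has_neighbor (G : sgraph) (v : G) :
  connected_graph G -> 1 < #|G| -> exists u, edge v u.
Proof.
move=> [_ conG]; rewrite -cardsT (cardsD1 v) inE ltnS => /card_gt0P[w].
case/setD1P => wv _; have /connectP[[|u p] /=] := conG v w.
  by move=> _ /eqP; rewrite (negPf wv).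
by case/andP=> vu _ _; exists u.
Qed.

Lemma tree_leaf (T : sgraph) :
  is_tree T -> 1 < #|T| -> exists v u : T, nbhd v = [set u].
Proof.
move=> [conT acT] T_gt1.
have T_neq0 : [set: T] != set0 by rewrite -card_gt0 cardsT ltnW.
have [v _] := acyclic_low_degree acT T_neq0; rewrite setIT => dv.
have [u vu] := connected_has_neighbor v conT T_gt1.
by exists v, u; apply/esym/eqP; rewrite eqEcard sub1set cards1 dv inE vu.
Qed.

(** Working with vertex subsets of a fixed acyclic graph lets the induction on [#|S|] delete a
    vertex without building subgraphs or preserving connectedness. *)
Lemma acyclic_surjective_coloring (G : sgraph) (S : {set G}) (k : nat) :
    acyclic_graph G -> 1 < k -> k <= #|S| ->
  exists c : G -> 'I_k,
    {in S &, forall u v, edge u v -> c u <> c v} /\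
    forall i, exists2 v, v \in S & c v = i.
Proof.
move=> acG k_gt1; have [n] := ubnP #|S|; elim: n S => // n IHn S /ltnSE leSn.
rewrite leq_eqVlt => /predU1P[Sk|ltkS].
  (* When [S] has exactly [k] vertices, their ranks in an enumeration of [S] are the colors; [x0]
     serves only to define the rank outside [S]. *)
  have /card_gt0P[x0 Sx0] : 0 < #|S| by rewrite -Sk ltnW.
  rewrite Sk; exists (enum_rank_in Sx0); split.
    move=> u v Su Sv uv /(enum_rank_in_inj Su Sv) uv'.
    by rewrite uv' edge_irrefl in uv.
  by move=> i; exists (enum_val i); rewrite ?enum_valP ?enum_valK_in.
have S_neq0 : S != set0 by rewrite -card_gt0 (leq_trans _ ltkS).
have [v Sv dv] := acyclic_low_degree acG S_neq0.
have Sv1 : #|S| = #|S :\ v|.+1 by rewrite (cardsD1 v) Sv.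
have [||c [cP c_surj]] := IHn (S :\ v).
- by rewrite -Sv1.
- by rewrite -ltnS -Sv1.
(* At most one neighbor of [v] is colored, and [1 < k] leaves a second color for [v]. *)
have [i iP] : exists i, forall u, u \in nbhd v :&: S -> c u != i.
  case: (set_0Vmem (nbhd v :&: S)) => [->|[w Nw]].
    by exists (Ordinal k_gt1) => u; rewrite inE.
  have /card_gt0P[i] : 0 < #|~: [set c w]|.
    by rewrite -(ltn_add2l #|[set c w]|) cardsC cards1 card_ord.
  rewrite !inE eq_sym => iP; exists i => u Nu.
  by rewrite (card_le1_eqP dv w u Nw Nu).
exists (fun u => if u == v then i else c u); split; last first.
  move=> j; have [u /setD1P[/negPf uv Su] <-] := c_surj j.
  by exists u => //; rewrite uv.
move=> x y Sx Sy xy; case: eqP => [xv|/eqP xv]; case: eqP => [yv|/eqP yv].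
- by rewrite xv yv edge_irrefl in xy.
- by apply/eqP; rewrite eq_sym iP // !inE Sy -xv xy.
- by apply/eqP; rewrite iP // !inE Sx -yv edge_sym xy.
- by apply: cP => //; rewrite !inE ?xv ?yv.
Qed.

Section JoinNeighborhoods.
Variables G1 G2 : sgraph.
Local Notation J := (join_graph G1 G2).

Lemma nbhd_joinl (v : G1) :
  nbhd (inl v : J) = (inl @: nbhd v : {set J}) :|: (inr @: [set: G2]).
Proof.
apply/setP=> -[u|u]; rewrite !inE /=.
  rewrite mem_imset ?inE; last exact: inl_inj.
  by case: imsetP => [[]|]; rewrite ?orbF.
by rewrite [X in _ || X]mem_imset ?inE ?orbT //; apply: inr_inj.
Qed.

Lemma nbhd_joinr (v : G2) :
  nbhd (inr v : J) = (inr @: nbhd v : {set J}) :|: (inl @: [set: G1]).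
Proof.
apply/setP=> -[u|u]; rewrite !inE /=.
  by rewrite [X in _ || X]mem_imset ?inE ?orbT //; apply: inl_inj.
rewrite mem_imset ?inE; last exact: inr_inj.
by case: imsetP => [[]|]; rewrite ?orbF.
Qed.

Lemma degree_joinl (v : G1) : degree (inl v : J) = degree v + #|G2|.
Proof.
rewrite /degree nbhd_joinl cardsU disjoint_setI0 ?cards0 ?subn0.
  by rewrite !card_imset ?cardsT //; [apply: inr_inj | apply: inl_inj].
by apply/pred0P=> x /=; apply/andP=> -[/imsetP[? _ ->] /imsetP[]].
Qed.

Lemma degree_joinr (v : G2) : degree (inr v : J) = degree v + #|G1|.
Proof.
rewrite /degree nbhd_joinr cardsU disjoint_setI0 ?cards0 ?subn0.
  by rewrite !card_imset ?cardsT //; [apply: inl_inj | apply: inr_inj].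
by apply/pred0P=> x /=; apply/andP=> -[/imsetP[? _ ->] /imsetP[]].
Qed.

End JoinNeighborhoods.

(** The vertex [u] adds at most one color to those of [B]. For a leaf of one tree in the join, [B]
    is the whole other tree. *)
Lemma conditional_coloring_nbhdU1 (G : sgraph) (k r : nat) (c : G -> 'I_k)
    (v u : G) (B : {set G}) :
    conditional_coloring r c -> r <= degree v -> nbhd v = u |: B ->
  r - 1 <= #|c @: B|.
Proof.
move=> [_ _ /(_ v) cv] /minn_idPr rv Nv; move: cv.
rewrite rv Nv imsetU1 cardsU1.
by rewrite leq_subLR => /leq_trans; apply; rewrite leq_add2r; case: (_ \in _).
Qed.

Theorem theorem2p2 (T1 T2 : sgraph) (n1 n2 r : nat)
    (tree1 : is_tree T1) (tree2 : is_tree T2)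
    (card1 : #|T1| = n1) (card2 : #|T2| = n2)
    (nontrivial1 : 1 < n1) (nontrivial2 : 1 < n2)
    (le_n12 : n1 <= n2) (r_ge4 : 4 <= r) (r_le : r <= n1 + 1) :
  is_chi (join_graph T1 T2) r (2 * (r - 1)).
Proof.
rewrite -card1 in nontrivial1; rewrite -card2 in nontrivial2.
have r_le1 : r <= 1 + #|T1| by rewrite card1 addnC.
have r_le2 : r <= 1 + #|T2|.
  by rewrite card2 (leq_trans r_le) // addnC leq_add2l.
have [v1 [u1 Nv1]] := tree_leaf tree1 nontrivial1.
have [v2 [u2 Nv2]] := tree_leaf tree2 nontrivial2.
(* In the join a leaf has degree one plus the order of the other tree, so the minimum in (C2) is [r]
   there. *)
have deg1 : r <= degree (inl v1 : join_graph T1 T2).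
  by rewrite degree_joinl /degree Nv1 cards1.
have deg2 : r <= degree (inr v2 : join_graph T1 T2).
  by rewrite degree_joinr /degree Nv2 cards1.
split; last first.
  move=> k [_ _ _ [c cP]]; pose J := join_graph T1 T2.
  have le2 : r - 1 <= #|c @: (inr @: [set: T2] : {set J})|.
    apply: (conditional_coloring_nbhdU1 (u := inl u1 : J) cP deg1).
    by rewrite nbhd_joinl Nv1 imset_set1.
  have le1 : r - 1 <= #|c @: (inl @: [set: T1] : {set J})|.
    apply: (conditional_coloring_nbhdU1 (u := inr u2 : J) cP deg2).
    by rewrite nbhd_joinr Nv2 imset_set1.
  (* The two color sets are disjoint because every cross pair is an edge, so their sizes add up to
     at most [k]. *)
  rewrite mul2n -addnn (leq_trans (leq_add le1 le2)) //.
  rewrite -cardsUI disjoint_setI0 ?cards0 ?addn0.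
    by rewrite -[leqRHS](card_ord k) max_card.
  apply/pred0P=> i /=; apply/andP=> -[/imsetP[_ /imsetP[x _ ->] ->]].
  case/imsetP=> _ /imsetP[y _ ->]; case: cP => _ proper _.
  exact: (proper (inl x) (inr y)).
have [[con1 ac1] [con2 ac2]] := (tree1, tree2).
have [k rk k_gt2] : exists2 k, r = k.+1 & 2 < k.
  by case: {+}r r_ge4 => // k; exists k.
move: r_le1 r_le2; rewrite rk subn1 mul2n /= -addnn !ltnS => k1 k2.
have k_gt1 : 1 < k := ltnW k_gt2.
have [|c1 [c1P c1_surj]] := @acyclic_surjective_coloring T1 setT k ac1 k_gt1.
  by rewrite cardsT.
have [|c2 [c2P c2_surj]] := @acyclic_surjective_coloring T2 setT k ac2 k_gt1.
  by rewrite cardsT.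
split.
- by rewrite addn_gt0 (ltnW k_gt1).
- by rewrite /= -rk (leq_trans deg1) // /max_degree leq_bigmax.
- by rewrite -addn1 leq_add2l (ltnW k_gt1).
(* With [k = r - 1], [T1] takes the first [k] of the [k + k] colors and [T2] the last [k]. *)
exists (fun x : join_graph T1 T2 =>
          match x with inl u => lshift k (c1 u) | inr u => rshift k (c2 u) end).
split.
- move=> i; case: (split_ordP i) => j ->.
    by have [v _ <-] := c1_surj j; exists (inl v).
  by have [v _ <-] := c2_surj j; exists (inr v).
- case=> u [] v /= uv.
  + by move/lshift_inj; apply: c1P.
  + by apply/eqP; rewrite eq_lrshift.
  + by apply/eqP; rewrite eq_rlshift.
  + by move/rshift_inj; apply: c2P.
(* It suffices to see [r = k + 1] colors: that of one neighbor in the same tree and all [k] of the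
   other tree. *)
move=> x; apply: leq_trans (geq_minr _ _) _; case: x => v.
  have [u vu] := connected_has_neighbor v con1 nontrivial1.
  have <- : #|lshift k (c1 u) |: [set rshift k i | i in 'I_k]| = k.+1.
    rewrite cardsU1 card_imset ?card_ord; last exact: rshift_inj.
    by case: imsetP => // -[i _ /eqP]; rewrite eq_lrshift.
  apply/subset_leq_card/subsetP=> i /setU1P[->|/imsetP[j _ ->]].
    by apply/imsetP; exists (inl u); rewrite ?inE.
  by have [w _ <-] := c2_surj j; apply/imsetP; exists (inr w); rewrite ?inE.
have [u vu] := connected_has_neighbor v con2 nontrivial2.
have <- : #|rshift k (c2 u) |: [set lshift k i | i in 'I_k]| = k.+1.
  rewrite cardsU1 card_imset ?card_ord; last exact: lshift_inj.
  by case: imsetP => // -[i _ /eqP]; rewrite eq_rlshift.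
apply/subset_leq_card/subsetP=> i /setU1P[->|/imsetP[j _ ->]].
  by apply/imsetP; exists (inr u); rewrite ?inE.
by have [w _ <-] := c1_surj j; apply/imsetP; exists (inl w); rewrite ?inE.
Qed.
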